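(* Let $K$ be a field, let $G$ be a complete multipartite graph with vertex set $V(G)=\{x_1,\ldots,x_n\}$ and with at least one edge, and let $R=K[x_1,\ldots,x_n]$. Then $\mathrm{v}(J(G))=\mathrm{reg}(R/J(G))=|V(G)|-2$.
   Context: Graphs are finite and simple. A graph $G$ is complete multipartite if there is a partition $V_1,\ldots,V_k$ of $V(G)$ (into nonempty partite sets) such that each induced subgraph $G[V_i]$ has no edges, and $\{a,b\}\in E(G)$ whenever $a\in V_i$, $b\in V_j$ with $i\neq j$. $R=K[x_1,\ldots,x_n]=\bigoplus_{d\ge 0}R_d$ has the standard grading; the vertices of $G$ are identified with the variables of $R$. A vertex cover of $G$ is a set $C\subseteq V(G)$ meeting every edge; it is minimal if it is minimal under inclusion. For $C\subseteq V(G)$ put $X_C=\prod_{x_i\in C}x_i$. The cover ideal of $G$ is $J(G)=\langle X_C : C \text{ a minimal vertex cover of } G\rangle=\bigcap_{\{x_i,x_j\}\in E(G)}\langle x_i,x_j\rangle$. For a proper graded ideal $I\subseteq R$, the $\mathrm{v}$-number is $\mathrm{v}(I)=\min\{d\ge 0 : \text{there exist } f\in R_d \text{ and } \mathfrak p\in \mathrm{Ass}(I) \text{ with } I:f=\mathfrak p\}$, where $\mathrm{Ass}(I)$ is the set of associated primes of $I$ (i.e. of $R/I$). $\mathrm{reg}(R/I)=\max\{j-i : \beta_{i,j}(R/I)\ne 0\}$ is the Castelnuovo-Mumford regularity, where $\beta_{i,j}(R/I)$ are the graded Betti numbers of $R/I$ over $R$. *)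

(* Defs.v *)
From HB Require Import structures.
From mathcomp Require Import all_boot all_order all_algebra.
From mathcomp.multinomials Require Export mpoly.

Set Implicit Arguments.
Unset Strict Implicit.
Unset Printing Implicit Defensive.

Import Order.TTheory GRing.Theory Num.Theory.
Local Open Scope ring_scope.

Definition is_min d (T : porderType d) (S : T -> Prop) (m : T) : Prop :=
  S m /\ forall x, S x -> (m <= x)%O.

Definition is_max d (T : porderType d) (S : T -> Prop) (m : T) : Prop :=
  S m /\ forall x, S x -> (x <= m)%O.

(* A finite simple graph with vertices x_1, ..., x_n is a symmetric irreflexive
   relation on 'I_n; the vertex i is identified with the variable 'X_i. *)
Section Graphs.
Variables (n : nat) (E : rel 'I_n).

Definition simple_graph : Prop := ssrbool.symmetric E /\ irreflexive E.

(* The blocks of a [partition] are nonempty. *)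
Definition complete_multipartite : Prop :=
  exists P : {set {set 'I_n}},
    [/\ partition P [set: 'I_n],
        forall A, A \in P -> {in A &, forall a b, ~~ E a b}
      & forall A B, A \in P -> B \in P -> A != B ->
          {in A & B, forall a b, E a b}].

Definition vertex_cover (C : {set 'I_n}) : bool :=
  [forall a, forall b, E a b ==> (a \in C) || (b \in C)].

Definition minimal_vertex_cover (C : {set 'I_n}) : bool :=
  minset vertex_cover C.

End Graphs.

(* Ideals are Prop-valued predicates, since ideal membership need not be given
   by a boolean function. *)
Section Ideals.
Variables (K : fieldType) (n : nat).
Local Notation R := {mpoly K[n]}.

Definition is_ideal (I : R -> Prop) : Prop :=
  [/\ I 0, forall f g, I f -> I g -> I (f + g)
    & forall f g, I g -> I (f * g)].

Definition is_prime_ideal (p : R -> Prop) : Prop :=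
  [/\ is_ideal p, ~ p 1 & forall f g, p (f * g) -> p f \/ p g].

Definition colon (I : R -> Prop) (f : R) : R -> Prop := fun g => I (g * f).

Definition same_ideal (I J : R -> Prop) : Prop := forall f, I f <-> J f.

(* [colon I f] is the annihilator of the class of f in R/I. *)
Definition associated_prime (I p : R -> Prop) : Prop :=
  is_prime_ideal p /\ exists f : R, same_ideal (colon I f) p.

Definition is_v_number (I : R -> Prop) (v : nat) : Prop :=
  is_min (fun d : nat => exists (f : R) (p : R -> Prop),
            [/\ f \is d.-homog, associated_prime I p
              & same_ideal (colon I f) p]) v.

Definition X_ (C : {set 'I_n}) : R := \prod_(i in C) 'X_i.

Definition cover_ideal (E : rel 'I_n) : R -> Prop :=
  fun f => exists c : {set 'I_n} -> R,
    f = \sum_(C | minimal_vertex_cover E C) c C * X_ C.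

(* R_z for z in Z, with R_z = 0 for z < 0. *)
Definition graded_piece (z : int) (f : R) : Prop :=
  match z with
  | Posz d => f \is d.-homog
  | Negz _ => f = 0
  end.

(* The data ... -> F_1 -> F_0 -> R/I, where F_i is the sum over a of the
   R(- shift i a). Elements of F_i are row vectors and maps are right
   multiplications by matrices: F_(i+1) -> F_i is [u |-> u *m diff i], and
   F_0 -> R/I is [u |-> class of u *m aug]. *)
Record free_complex := FreeComplex {
  rk : nat -> nat;
  shift : forall i, 'I_(rk i) -> int;
  diff : forall i, 'M[R]_(rk i.+1, rk i);
  aug : 'cV[R]_(rk 0)
}.

Arguments shift F [i] a : rename.
Arguments diff F i : rename.

Definition graded_complex (F : free_complex) : Prop :=
  (forall i a b, graded_piece (shift F a - shift F b) (diff F i a b)) /\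
  (forall a, graded_piece (shift F a) (aug F a 0)).

Definition resolves (I : R -> Prop) (F : free_complex) : Prop :=
  [/\ forall f : R, exists u : 'rV_(rk F 0), I (f - (u *m aug F) 0 0),
      forall u : 'rV_(rk F 0),
        I ((u *m aug F) 0 0) <-> exists w, u = w *m diff F 0
    & forall i (u : 'rV_(rk F i.+1)),
        u *m diff F i = 0 <-> exists w, u = w *m diff F i.+1].

(* The differentials have entries in <x_1, ..., x_n>. *)
Definition minimal_complex (F : free_complex) : Prop :=
  forall i a b, (diff F i a b)@_(0%MM) = 0.

Definition minimal_graded_free_resolution (I : R -> Prop) (F : free_complex) :
    Prop :=
  [/\ graded_complex F, resolves I F & minimal_complex F].

(* b = beta_{i,j}(R/I), the number of summands R(-j) in homological degree i
   of a minimal graded free resolution of R/I. *)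
Definition graded_betti (I : R -> Prop) (i : nat) (j : int) (b : nat) : Prop :=
  exists F, minimal_graded_free_resolution I F /\
            b = #|[set a : 'I_(rk F i) | shift F a == j]|.

(* r = reg(R/I) *)
Definition is_regularity (I : R -> Prop) (r : int) : Prop :=
  is_max (fun z : int => exists (i : nat) (j : int) (b : nat),
            [/\ graded_betti I i j b, b != 0%N & z = j - i%:Z]) r.

End Ideals.

Arguments cover_ideal K {n} E _.

(* Main.v *)
(* The minimal vertex covers are the complements of the blocks V_1, ..., V_k, so
   J is generated by the X_V / q_i with q_i = X_(V_i).  Its syzygies are
   generated by the q_i e_i - q_1 e_1, which are independent and of degree n;
   this gives a resolution 0 -> R(-n)^(k-1) -> (+)_i R(-(n - |V_i|)) -> R, and
   the regularity n - 2.
   For an edge {a, b}, J : X_(V \ {a, b}) = <x_a, x_b>, so v(J) <= n - 2.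
   Conversely, if J : f is prime, it contains two variables x_a, x_b from
   different blocks.  Some monomial m of f is not in J, while x_a m and x_b m
   are; then m involves every variable except perhaps x_a and x_b, so its degree
   is at least n - 2. *)
From HB Require Import structures.
Require Import Defs.
From mathcomp Require Import all_boot all_order all_algebra.
From mathcomp Require Import zify.

Set Implicit Arguments.
Unset Strict Implicit.
Unset Printing Implicit Defensive.

Import Order.TTheory GRing.Theory Num.Theory.
Local Open Scope ring_scope.

(** * Homogeneous parts of polynomials and graded matrices *)

Section Grading.
Variables (K : fieldType) (n : nat).
Local Notation R := {mpoly K[n]}.
Implicit Types (f g : R) (z s t : int).

(** Integer degrees are needed because they arise as differences of shifts, which may be
    negative. *)
Definition homog_part z f : R :=
  match z with
  | Posz d => pihomog mdeg d f
  | Negz _ => 0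
  end.

Lemma graded_piece0 z : graded_piece z (0 : R).
Proof. by case: z => d //=; apply: dhomog0. Qed.

Lemma graded_pieceD z f g :
  graded_piece z f -> graded_piece z g -> graded_piece z (f + g).
Proof.
case: z => d /=; first exact: dhomogD.
by move=> -> ->; rewrite addr0.
Qed.

Lemma graded_pieceN z f : graded_piece z f -> graded_piece z (- f).
Proof.
case: z => d /=; first by rewrite dhomogN.
by move=> ->; rewrite oppr0.
Qed.

Lemma graded_piece_sum (I : finType) z (F : I -> R) :
  (forall i, graded_piece z (F i)) -> graded_piece z (\sum_i F i).
Proof.
move=> zF; apply: big_ind => //; [exact: graded_piece0 | exact: graded_pieceD].
Qed.

Lemma graded_pieceM s t f g :
  graded_piece s f -> graded_piece t g -> graded_piece (s + t) (f * g).
Proof.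
case: s => d /=; last by move=> -> _; rewrite mul0r; apply: graded_piece0.
case: t => e /= hf; last by move=> ->; rewrite mulr0; apply: graded_piece0.
by move=> hg; apply: dhomogM.
Qed.

Lemma homog_partP z f : graded_piece z (homog_part z f).
Proof. by case: z => d //=; apply: pihomogP. Qed.

Lemma homog_part_sum (I : Type) (r : seq I) (P : pred I) z (F : I -> R) :
  homog_part z (\sum_(i <- r | P i) F i) =
  \sum_(i <- r | P i) homog_part z (F i).
Proof. by case: z => d /=; rewrite ?raddf_sum // big1. Qed.

Lemma homog_partB z f g :
  homog_part z (f - g) = homog_part z f - homog_part z g.
Proof. by case: z => d /=; rewrite ?raddfB ?subr0. Qed.

Lemma homog_part_piece z s f :
  graded_piece s f -> homog_part z f = if z == s then f else 0.
Proof.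
case: s => e /=.
  2: by move=> ->; rewrite if_same; case: z => d //=; rewrite raddf0.
case: z => d //= hf; have [->|neq] := eqVneq d e.
  by rewrite eqxx pihomog_dE.
by rewrite eqz_nat (negPf neq); apply: pihomog_ne0 hf; rewrite eq_sym.
Qed.

(** Both sides are linear in [f], and for a single term they are both the full product or both
    zero. *)
Lemma homog_partM z t f g :
  graded_piece t g -> homog_part z (f * g) = homog_part (z - t) f * g.
Proof.
move=> hg; rewrite [f]mpolyE mulr_suml !homog_part_sum mulr_suml.
apply: eq_bigr => m _.
have hX : graded_piece (mdeg m) (f@_m *: 'X_[m] : R).
  by apply: dhomogZ; rewrite dhomogX.
rewrite (homog_part_piece _ hX) (homog_part_piece _ (graded_pieceM hX hg)).
by rewrite subr_eq; case: eqP => //; rewrite mul0r.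
Qed.

(** Turns an invertible entry of a graded matrix into an equality of shifts. *)
Lemma graded_piece_mcoeff0 z f : graded_piece z f -> f@_0%MM != 0 -> z = 0.
Proof.
case: z => d /=; last by move=> ->; rewrite mcoeff0 eqxx.
by rewrite -mcoeff_msupp => /dhomogP hf /hf <-; rewrite mf0.
Qed.

Definition graded_matrix p q (s : 'I_p -> int) (t : 'I_q -> int)
    (A : 'M[R]_(p, q)) : Prop :=
  forall a b, graded_piece (s a - t b) (A a b).

Lemma graded_mulmx p q r (s : 'I_p -> int) (t : 'I_q -> int) (u : 'I_r -> int)
    (A : 'M[R]_(p, q)) (B : 'M[R]_(q, r)) :
  graded_matrix s t A -> graded_matrix t u B -> graded_matrix s u (A *m B).
Proof.
move=> hA hB a c; rewrite mxE; apply: graded_piece_sum => b.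
by rewrite -(subrKA (t b)); apply: graded_pieceM.
Qed.

(** Cutting each entry of [W] down to its expected degree keeps the product, since [C] and [D] are
    already homogeneous. *)
Lemma graded_factor p q r (s : 'I_p -> int) (t : 'I_q -> int) (u : 'I_r -> int)
    (C : 'M[R]_(p, r)) (W : 'M[R]_(p, q)) (D : 'M[R]_(q, r)) :
  graded_matrix s u C -> graded_matrix t u D -> C = W *m D ->
  exists2 W', graded_matrix s t W' & C = W' *m D.
Proof.
move=> hC hD defC; exists (\matrix_(a, b) homog_part (s a - t b) (W a b)).
  by move=> a b; rewrite mxE; apply: homog_partP.
apply/matrixP => a c; move: (hC a c) => /(homog_part_piece (s a - u c)).
rewrite eqxx => <-; rewrite defC !mxE homog_part_sum; apply: eq_bigr => b _.
by rewrite mxE (homog_partM _ _ (hD b c)) opprB addrA addrNK.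
Qed.

End Grading.

(** * Comparison of a minimal free resolution with an arbitrary graded one *)

Section Comparison.
Variables (K : fieldType) (n : nat).
Local Notation R := {mpoly K[n]}.
Implicit Types (I : R -> Prop) (F G : free_complex K n).

Lemma ideal_sum I (T : Type) (r : seq T) (P : pred T) (f : T -> R) :
  is_ideal I -> (forall i, P i -> I (f i)) -> I (\sum_(i <- r | P i) f i).
Proof. by case=> I0 ID _ If; apply: big_ind. Qed.

Lemma ideal_mulmx I p q (A : 'M[R]_(p, q)) (v : 'cV_q) :
  is_ideal I -> (forall b, I (v b 0)) -> forall a, I ((A *m v) a 0).
Proof.
move=> idI Iv a; rewrite mxE; apply: ideal_sum => // b _.
by case: idI => _ _; apply.
Qed.

Lemma row_factor p q r (C : 'M[R]_(p, r)) (D : 'M[R]_(q, r)) :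
  (forall a, exists w, row a C = w *m D) -> exists W, C = W *m D.
Proof.
move=> /fin_all_exists[w defC]; exists (\matrix_a w a).
by apply/row_matrixP => a; rewrite row_mul rowK.
Qed.

(** Free modules are projective: the rows of [C] are cycles, hence boundaries, and chosen preimages
    form [W]. *)
Lemma resolves_lift I F i p (C : 'M[R]_(p, rk F i.+1)) :
  resolves I F -> C *m diff F i = 0 -> exists W, C = W *m diff F i.+1.
Proof.
move=> [_ _ exF] C0; apply: row_factor => a; apply/exF.
by rewrite -row_mul C0 row0.
Qed.

Lemma resolves_diff2 I F i : resolves I F -> diff F i.+1 *m diff F i = 0.
Proof.
move=> [_ _ exF]; apply/row_matrixP => a; rewrite row_mul row0.
by apply/exF; exists (delta_mx 0 a); rewrite rowE.
Qed.

Lemma resolves_lift0 I F p (C : 'M[R]_(p, rk F 0)) :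
  resolves I F -> (forall a, I ((C *m aug F) a 0)) ->
  exists W, C = W *m diff F 0.
Proof.
move=> [_ exF _] IC; apply: row_factor => a; apply/exF.
by move: (IC a); rewrite -row_mul [(row _ _) 0 0]mxE.
Qed.

Lemma resolves_aug_diff I F a : resolves I F -> I ((diff F 0 *m aug F) a 0).
Proof.
move=> [_ exF _].
have -> : (diff F 0 *m aug F) a 0 = (row a (diff F 0) *m aug F) 0 0.
  by rewrite -row_mul [RHS]mxE.
by apply/exF; exists (delta_mx 0 a); rewrite rowE.
Qed.

Lemma resolves_lift_aug I F p (v : 'cV[R]_p) :
  resolves I F -> exists W, forall a, I ((v - W *m aug F) a 0).
Proof.
move=> [sF _ _].
have /fin_all_exists[w Iw] (a : 'I_p) := sF (v a 0).
exists (\matrix_a w a) => a; move: (Iw a).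
by rewrite !mxE; under [in X in _ -> X]eq_bigr do rewrite mxE.
Qed.

(** Since I is graded, the congruence for an arbitrary lift survives passing to homogeneous
    parts. *)
Lemma graded_lift_aug I F p (s : 'I_p -> int) (v : 'cV[R]_p) :
    (forall z f, I f -> I (homog_part z f)) ->
    resolves I F -> graded_complex F ->
    (forall a, graded_piece (s a) (v a 0)) ->
  exists2 W, graded_matrix s (@shift K n F 0) W
    & forall a, I ((v - W *m aug F) a 0).
Proof.
move=> gI resF [_ gF] gv; have [W IW] := resolves_lift_aug v resF.
exists (\matrix_(a, b) homog_part (s a - shift b) (W a b)).
  by move=> a b; rewrite mxE; apply: homog_partP.
move=> a; have := gI (s a) _ (IW a); rewrite !mxE homog_partB.
rewrite (homog_part_piece _ (gv a)) eqxx homog_part_sum.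
congr (I (_ - _)); apply: eq_bigr => b _.
by rewrite mxE (homog_partM _ _ (gF b)).
Qed.

Lemma mcoeff0_mulmx p q r (A : 'M[R]_(p, q)) (B : 'M[R]_(q, r)) a c :
  ((A *m B) a c)@_0%MM = \sum_b (A a b)@_0%MM * (B b c)@_0%MM.
Proof. by rewrite mxE raddf_sum; apply: eq_bigr => b _; rewrite /= rmorphM. Qed.

(* [A] is degree i of a graded chain map F -> G over the identity of R/I, [B]
   is degree i of a chain map back, and [h], [e] express that [A *m B] is
   homotopic to the identity, [e] being the part of the homotopy that factors
   through degree i - 1.  Minimality makes [A *m B] the identity modulo the
   variables, so that [A] has an invertible entry in each row. *)
Definition comparison F G i : Prop :=
  exists (A : 'M[R]_(rk F i, rk G i)) (B : 'M[R]_(rk G i, rk F i))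
         (h : 'M[R]_(rk F i, rk F i.+1)) (e : 'M[R]_(rk F i)),
    [/\ [/\ graded_matrix (@shift K n F i) (@shift K n G i) A,
            exists A', diff F i *m A = A' *m diff G i
          & exists B', diff G i *m B = B' *m diff F i],
        A *m B = 1%:M + h *m diff F i + e,
        diff F i *m e = 0
      & forall a b, (e a b)@_0%MM = 0].

(** Each augmentation lifts through the other modulo I, so [A *m B - 1%:M] sends [aug F] into I and
    factors through [diff F 0]. Nothing precedes degree 0, so [e] is 0. *)
Lemma comparison0 I F G :
    is_ideal I -> (forall z f, I f -> I (homog_part z f)) ->
    resolves I F -> graded_complex F -> resolves I G -> graded_complex G ->
  comparison F G 0.
Proof.
move=> idI gI resF grF resG grG.
have IB (f g : R) : I f -> I g -> I (f - g).
  by case: idI => _ ID IM If Ig; apply: ID => //; rewrite -mulN1r; apply: IM.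
have Isub p (u v : 'cV[R]_p) : (forall a, I (u a 0)) ->
    (forall a, I ((u - v) a 0)) -> forall a, I (v a 0).
  move=> Iu Iuv a; have -> : v a 0 = u a 0 - (u - v) a 0 by rewrite !mxE subKr.
  exact: IB.
have [A gA IA] := graded_lift_aug gI resG grG (proj2 grF).
have [B IB'] := resolves_lift_aug (aug G) resF.
have /resolves_lift0[//|h defAB] : forall a, I (((A *m B - 1%:M) *m aug F) a 0).
  move=> a; rewrite mulmxBl mul1mx -mulmxA.
  have -> : A *m (B *m aug F) - aug F =
      - (aug F - A *m aug G) - A *m (aug G - B *m aug F).
    by rewrite mulmxBr !opprB [RHS]addrC subrKA.
  rewrite mxE [X in I (_ + X)]mxE; apply: IB; last exact: ideal_mulmx.
  rewrite mxE -mulN1r; case: idI => _ _; apply; exact: IA.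
exists A, B, h, 0; split; last 2 first.
- by rewrite mulmx0.
- by move=> a b; rewrite mxE mcoeff0.
- split=> //.
    (* Composed with [aug G], this is congruent modulo I to [diff F 0 *m aug F], whose entries lie
       in I. *)
    apply: (resolves_lift0 resG) => a.
    apply: (Isub _ (diff F 0 *m aug F)) => {}a; first exact: resolves_aug_diff.
    by rewrite -mulmxA -mulmxBr; apply: ideal_mulmx.
  apply: (resolves_lift0 resF) => a.
  apply: (Isub _ (diff G 0 *m aug G)) => {}a; first exact: resolves_aug_diff.
  by rewrite -mulmxA -mulmxBr; apply: ideal_mulmx.
- by rewrite addr0 -defAB addrC subrK.
Qed.

(** [A' *m B' - 1%:M - diff F i *m h] composes to zero with [diff F i], which yields the next
    homotopy. The new [e] is [diff F i *m h]: the next differential kills it, and minimality of [F]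
    removes its constant terms. *)
Lemma comparisonS I F G i :
    resolves I F -> graded_complex F -> minimal_complex F ->
    resolves I G -> graded_complex G ->
  comparison F G i -> comparison F G i.+1.
Proof.
move=> resF grF minF resG grG [A] [B] [h] [e] [[gA [A1 dA] [B' dB]] AB de _].
have [A' gA' dA'] : exists2 A', graded_matrix (@shift K n F i.+1)
    (@shift K n G i.+1) A' & diff F i *m A = A' *m diff G i.
  by apply: (graded_factor _ _ dA); [apply: graded_mulmx gA; apply: (proj1 grF)
    | apply: (proj1 grG)].
have dABd : (A' *m B') *m diff F i = diff F i + diff F i *m h *m diff F i.
  rewrite -mulmxA -dB mulmxA -dA' -mulmxA AB !mulmxDr de addr0 mulmx1.
  by rewrite mulmxA.
have /(resolves_lift resF)[h' defh'] :
    (A' *m B' - 1%:M - diff F i *m h) *m diff F i = 0.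
  by rewrite 2!mulmxBl mul1mx dABd addrAC addrK subrr.
exists A', B', h', (diff F i *m h); split.
- split=> //.
    by apply: (resolves_lift resG); rewrite -mulmxA -dA' mulmxA
      (resolves_diff2 _ resF) mul0mx.
  by apply: (resolves_lift resF); rewrite -mulmxA -dB mulmxA
    (resolves_diff2 _ resG) mul0mx.
- by rewrite -addrA -defh' addrNK [RHS]addrC addrNK.
- by rewrite mulmxA (resolves_diff2 _ resF) mul0mx.
- by move=> a b; rewrite mcoeff0_mulmx big1 // => c _; rewrite minF mul0r.
Qed.

(** Transfers a bound on shifts from one known resolution [G] to every minimal one. Modulo the
    variables [A *m B] has diagonal entry 1, so row [a] of [A] has an entry with nonzero constant
    term, and homogeneity equates the shifts. *)
Theorem minimal_resolution_shift I F G i (a : 'I_(rk F i)) :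
    is_ideal I -> (forall z f, I f -> I (homog_part z f)) ->
    minimal_graded_free_resolution I F -> resolves I G -> graded_complex G ->
  exists b : 'I_(rk G i), shift b = shift a.
Proof.
move=> idI gI [grF resF minF] resG grG.
have [A [B] [h] [e] [[gA _ _] AB _ e0]] : comparison F G i.
  elim: i {a} => [|i IHi]; first exact: (comparison0 idI).
  exact: (comparisonS resF grF minF resG grG IHi).
have : ((A *m B) a a)@_0%MM != 0.
  rewrite AB !mxE !mcoeffD e0 eqxx mcoeff1 eqxx addr0 raddf_sum big1 ?addr0.
    exact: oner_neq0.
  by move=> b _; rewrite /= rmorphM /= minF mulr0.
rewrite mcoeff0_mulmx => AB0.
have [b Ab|A0] := pickP (fun b => (A a b)@_0%MM != 0).
  exists b; apply/eqP; rewrite eq_sym -subr_eq0; apply/eqP.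
  exact: graded_piece_mcoeff0 (gA a b) Ab.
case/eqP: AB0; rewrite big1 // => b _.
by move: (A0 b) => /negbFE/eqP ->; rewrite mul0r.
Qed.

End Comparison.

(** * Divisibility and cancellation for squarefree monomials *)

Section SquarefreeMonomials.
Variables (K : fieldType) (n : nat).
Local Notation R := {mpoly K[n]}.
Implicit Types (f g : R) (m : 'X_{1..n}) (C D : {set 'I_n}).

Definition mnm_vars m : {set 'I_n} := [set i | (0 < m i)%N].

Lemma mnm_varsD m1 m2 : mnm_vars (m1 + m2) = mnm_vars m1 :|: mnm_vars m2.
Proof. by apply/setP=> i; rewrite !inE mnmDE addn_gt0. Qed.

Lemma mnm_vars_mesym1 C : mnm_vars (mesym1 C) = C.
Proof. by apply/setP=> i; rewrite inE mnmE; case: (i \in C). Qed.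

Lemma mnm_varsU i : mnm_vars U_(i) = [set i].
Proof. by rewrite -mesym1_set1 mnm_vars_mesym1. Qed.

Lemma mesym1_le C m : (mesym1 C <= m)%MM = (C \subset mnm_vars m).
Proof.
apply/mnm_lepP/subsetP => [le_Cm i iC|sCm i].
  by have := le_Cm i; rewrite mnmE inE iC.
by rewrite mnmE; case: (boolP (i \in C)) => // /sCm; rewrite inE.
Qed.

Lemma card_mnm_vars m : (#|mnm_vars m| <= mdeg m)%N.
Proof.
rewrite mdegE -sum1_card big_mkcond; apply: leq_sum => i _.
by rewrite inE; case: (m i).
Qed.

Lemma X_mesym1 C : X_ K C = 'X_[mesym1 C].
Proof.
rewrite /X_ mprodXE; congr 'X_[_]; apply/mnmP => i.
rewrite mnmE mnm_sumE big_mkcond (bigD1 i) //= mnmE eqxx big1 ?addn0 //.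
by move=> j ne_ji; case: ifP => // _; rewrite mnmE (negPf ne_ji).
Qed.

Lemma X_neq0 C : X_ K C != 0.
Proof. by rewrite X_mesym1 -msupp_eq0 msuppX. Qed.

Lemma X_homog C : X_ K C \is #|C|.-homog.
Proof. by rewrite X_mesym1 dhomogX /= mdeg_mesym1. Qed.

Lemma X_mcoeff0 C : C != set0 -> (X_ K C)@_0%MM = 0.
Proof.
move=> C_neq0; rewrite X_mesym1 mcoeffX -mdeg_eq0 mdeg_mesym1 cards_eq0.
by rewrite (negPf C_neq0).
Qed.

Lemma X_mulC C : X_ K (~: C) * X_ K C = X_ K setT.
Proof.
rewrite /X_ [RHS](bigID [in C]) /= mulrC.
by congr (_ * _); apply: eq_bigl => i; rewrite !inE.
Qed.

(** Divisibility of a term by a squarefree monomial depends only on which variables occur; the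
    quotient is formed term by term. *)
Lemma X_dvdP C f :
  (exists g, f = g * X_ K C) <->
  (forall m, m \in msupp f -> C \subset mnm_vars m).
Proof.
split=> [[g ->] m|sCf].
  rewrite X_mesym1 (perm_mem (msuppMX _ _)) => /mapP[m' _ ->].
  by rewrite mnm_varsD mnm_vars_mesym1 subsetUl.
exists (\sum_(m <- msupp f) f@_m *: 'X_[m - mesym1 C]).
rewrite {1}[f]mpolyE mulr_suml !big_seq; apply: eq_bigr => m /sCf sCm.
by rewrite -scalerAl X_mesym1 -mpolyXD submK // mesym1_le.
Qed.

(** The two monomials are coprime: in a term of [f * X_ K C], the variables of [D] can only come
    from [f]. *)
Lemma X_dvd_cancel C D f g :
  [disjoint C & D] -> f * X_ K C = g * X_ K D -> exists h, f = h * X_ K D.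
Proof.
move=> disCD eq_fg; apply/X_dvdP => m m_f.
have : (mesym1 C + m)%MM \in msupp (f * X_ K C).
  by rewrite X_mesym1 (perm_mem (msuppMX _ _)) map_f.
rewrite eq_fg => /(proj1 (X_dvdP D (g * X_ K D)) (ex_intro _ g erefl)).
rewrite mnm_varsD mnm_vars_mesym1 -subDset.
by move: disCD; rewrite disjoint_sym => /setDidPl ->.
Qed.

Lemma prime_X_mem (p : R -> Prop) C :
  is_prime_ideal p -> p (X_ K C) -> exists2 i, i \in C & p 'X_i.
Proof.
move=> [_ p1 pM]; rewrite /X_ -big_enum /=.
have: {subset enum C <= C} by move=> i; rewrite mem_enum.
elim: (enum C) => [|i s IHs] sC; first by rewrite big_nil.
rewrite big_cons => /pM[pi|]; first by exists i => //; apply/sC/mem_head.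
by apply: IHs => j js; apply: sC; rewrite inE js orbT.
Qed.

End SquarefreeMonomials.

(** * The cover ideal as a graded monomial ideal *)

Section CoverIdeal.
Variables (K : fieldType) (n : nat) (E : rel 'I_n).
Local Notation R := {mpoly K[n]}.
Implicit Types (f g : R) (m : 'X_{1..n}) (C : {set 'I_n}).

Lemma cover_ideal_is_ideal : is_ideal (cover_ideal K E).
Proof.
split=> [|_ _ [c ->] [d ->]|f _ [c ->]].
- by exists (fun=> 0); rewrite big1 // => C _; rewrite mul0r.
- exists (fun C => c C + d C); rewrite -big_split.
  by apply: eq_bigr => C _; rewrite mulrDl.
- exists (fun C => f * c C); rewrite mulr_sumr.
  by apply: eq_bigr => C _; rewrite mulrA.
Qed.

Lemma cover_ideal_X C : minimal_vertex_cover E C -> cover_ideal K E (X_ K C).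
Proof.
move=> minC; exists (fun D => (D == C)%:R).
rewrite (bigD1 C) //= eqxx mul1r big1 ?addr0 // => D /andP[_ neqDC].
by rewrite (negPf neqDC) mul0r.
Qed.

Lemma cover_ideal_sub (I : R -> Prop) :
    is_ideal I -> (forall C, minimal_vertex_cover E C -> I (X_ K C)) ->
  forall f, cover_ideal K E f -> I f.
Proof.
move=> idI IX _ [c ->]; apply: ideal_sum => // C /IX.
by case: idI => _ _; apply.
Qed.

(** The generators are homogeneous, so cutting the coefficients by degree suffices. *)
Lemma cover_ideal_homog_part z f :
  cover_ideal K E f -> cover_ideal K E (homog_part z f).
Proof.
move=> [c ->]; exists (fun C => homog_part (z - #|C|%:Z) (c C)).
rewrite homog_part_sum; apply: eq_bigr => C _; apply: homog_partM.
exact: X_homog.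
Qed.

Definition mnm_covers m : bool :=
  [exists C, minimal_vertex_cover E C && (C \subset mnm_vars m)].

Lemma mnm_coversP m :
  reflect (exists2 C, minimal_vertex_cover E C & C \subset mnm_vars m)
          (mnm_covers m).
Proof.
by apply: (iffP existsP) => [[C /andP[]]|[C]]; exists C => //; apply/andP.
Qed.

(** Membership in a monomial ideal is decided term by term: a term belongs exactly when a generator
    divides it. *)
Lemma cover_ideal_msupp f :
  cover_ideal K E f <-> all mnm_covers (msupp f).
Proof.
split=> [[c ->]|/allP fJ].
  apply/allP => m /msupp_sum_le/flatten_mapP[C].
  rewrite mem_filter => /andP[minC _] m_cX; apply/mnm_coversP; exists C => //.
  by move: m m_cX; apply/X_dvdP; exists (c C).
rewrite [f]mpolyE big_seq; have [J0 JD JM] := cover_ideal_is_ideal.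
apply: big_ind => // m /fJ/mnm_coversP[C minC sCm].
have [|g ->] := proj2 (X_dvdP C (f@_m *: 'X_[m])).
  by move=> m' /msuppZ_le; rewrite msuppX inE => /eqP ->.
exact/JM/cover_ideal_X.
Qed.

(** * The prime of an edge as a colon ideal *)

Section Edge.
Variables a b : 'I_n.
Hypotheses (E_simple : simple_graph E) (Eab : E a b).

(* Setting x_a = x_b = 0; the kernel is <x_a, x_b>. *)
Definition kill2 : R -> R :=
  comp_mpoly [tuple if (i == a) || (i == b) then 0 else 'X_i | i < n].

HB.instance Definition _ := GRing.RMorphism.on kill2.

Lemma kill2X m :
  kill2 'X_[m] = if (m a == 0%N) && (m b == 0%N) then 'X_[m] else 0.
Proof.
rewrite /kill2 comp_mpolyX.
have kill c : (c == a) || (c == b) -> m c != 0%N ->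
    \prod_(i < n) tnth [tuple if (i == a) || (i == b) then 0 else 'X_i : R
                       | i < n] i ^+ m i = 0.
  by move=> c_ab mc; rewrite (bigD1 c) //= tnth_mktuple c_ab expr0n (negPf mc)
    mul0r.
have [ma|ma] := eqVneq (m a) 0%N; last by rewrite (kill a) ?eqxx.
have [mb|mb] := eqVneq (m b) 0%N; last by rewrite (kill b) ?eqxx ?orbT.
rewrite [RHS]mpolyXE_id; apply: eq_bigr => i _; rewrite tnth_mktuple.
by case: ifP => // /orP[] /eqP ->; rewrite ?ma ?mb !expr0.
Qed.

Lemma edge_neq : a != b.
Proof. by apply: contraTneq Eab => ->; rewrite (proj2 E_simple). Qed.

Lemma vertex_coverC1 (c : 'I_n) : vertex_cover E (~: [set c]).
Proof.
apply/forallP => x; apply/forallP => y; apply/implyP => Exy; rewrite !inE.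
rewrite -negb_and; apply: contraTN Exy => /andP[/eqP -> /eqP ->].
by rewrite (proj2 E_simple).
Qed.

Lemma kill2_X_cover C : vertex_cover E C -> kill2 (X_ K C) = 0.
Proof.
move=> /forallP/(_ a)/forallP/(_ b)/implyP/(_ Eab) abC.
rewrite X_mesym1 kill2X !mnmE !eqb0; move: abC.
by case: (a \in C); case: (b \in C).
Qed.

(** Every cover meets the edge, so [kill2] annihilates J; it fixes [X_ K (~: [set a; b])], which
    cancels in a domain. Conversely, multiplying that monomial by one containing x_a or x_b involves
    all vertices but at most one, and these form a cover as there are no loops. *)
Lemma colon_edge :
  same_ideal (colon (cover_ideal K E) (X_ K (~: [set a; b])))
             (fun g => kill2 g = 0).
Proof.
have [J0 JD JM] := cover_ideal_is_ideal.
move=> g; split=> [Jg|g0].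
  have : kill2 (g * X_ K (~: [set a; b])) = 0.
    apply: (cover_ideal_sub (I := fun h => kill2 h = 0) _ _ Jg) => [|C].
      2: by move=> /minsetp; exact: kill2_X_cover.
    split=> [|f h|f h]; first exact: rmorph0.
      by rewrite rmorphD /= => -> ->; rewrite addr0.
    by rewrite rmorphM /= => ->; rewrite mulr0.
  rewrite rmorphM /= [kill2 (X_ _ _)](_ : _ = X_ K (~: [set a; b])).
    by move/eqP; rewrite mulf_eq0 (negPf (X_neq0 _ _)) orbF => /eqP.
  by rewrite X_mesym1 kill2X !mnmE !inE !eqxx orbT.
(* The subtracted terms add up to [kill2 g = 0]; what remains are the terms divisible by x_a or
   x_b. *)
have -> : g = \sum_(m <- msupp g) g@_m *: ('X_[m] - kill2 'X_[m]).
  under [RHS]eq_bigr do rewrite scalerBr; rewrite sumrB -mpolyE -[LHS]subr0.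
  congr (_ - _); rewrite -{1}g0 {1}[g]mpolyE raddf_sum.
  by apply: eq_bigr => m _; rewrite /= /kill2 comp_mpolyZ.
rewrite /colon mulr_suml.
apply: (ideal_sum _ cover_ideal_is_ideal) => m _.
rewrite -scalerAl -mul_mpolyC; apply: JM.
rewrite kill2X; case: ifP => [_|]; first by rewrite subrr mul0r.
move=> /negbT; rewrite negb_and subr0 -!lt0n => mab.
(* [c] is the endpoint opposite to one whose variable occurs in [m]. *)
have [c abc cov] : exists2 c, vertex_cover E (~: [set c])
    & ~: [set c] \subset mnm_vars m :|: ~: [set a; b].
  case/orP: mab => [ma|mb]; [exists b | exists a]; try exact: vertex_coverC1.
    apply/subsetP => x; rewrite !inE orbC => /negPf ->; rewrite orbF.
    by case: eqP => // ->.
  apply/subsetP => x; rewrite !inE orbC => /negPf ->.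
  by case: eqP => // ->.
have [D minD sDc] := minset_exists abc.
apply/cover_ideal_msupp; rewrite X_mesym1 -mpolyXD msuppX /= andbT.
apply/mnm_coversP; exists D => //; rewrite mnm_varsD mnm_vars_mesym1.
exact: subset_trans sDc cov.
Qed.

(** The kernel of a ring morphism into a domain. *)
Lemma kill2_prime : is_prime_ideal (fun g => kill2 g = 0).
Proof.
split; first split.
- exact: rmorph0.
- by move=> f g; rewrite rmorphD /= => -> ->; rewrite addr0.
- by move=> f g; rewrite rmorphM /= => ->; rewrite mulr0.
- by rewrite rmorph1; apply/eqP/oner_neq0.
- move=> f g /eqP; rewrite rmorphM mulf_eq0.
  by case/orP => /eqP; [left | right].
Qed.

Lemma v_number_witness : exists (f : R) (p : R -> Prop),
  [/\ f \is (n - 2).-homog, associated_prime (cover_ideal K E) p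
    & same_ideal (colon (cover_ideal K E) f) p].
Proof.
exists (X_ K (~: [set a; b])), (fun g => kill2 g = 0); split.
- have := X_homog K (~: [set a; b]); rewrite cardsCs setCK cards2.
  by rewrite edge_neq card_ord.
- split; first exact: kill2_prime.
  by exists (X_ K (~: [set a; b])); apply: colon_edge.
- exact: colon_edge.
Qed.

End Edge.

End CoverIdeal.

(** * The resolution attached to disjoint blocks, and its regularity *)

Section DisjointBlocks.
Variables (K : fieldType) (n k : nat) (V : 'I_k.+1 -> {set 'I_n}).
Local Notation R := {mpoly K[n]}.

Definition block_gens : 'cV[R]_k.+1 := \col_i X_ K (~: V i).

(* Row i is the syzygy q_(i+1) e_(i+1) - q_0 e_0, where q_j = X_(V_j): the
   generators are X_V / q_j when the blocks cover all the vertices. *)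
Definition block_syz : 'M[R]_(k, k.+1) :=
  \matrix_(i, j) (X_ K (V j) *+ (j == lift ord0 i) - X_ K (V j) *+ (j == ord0)).

(** The catch-all shift [n] serves degree 2, where a syzygy pairs an entry q_j with a generator of
    degree n - |V_j|. From degree 3 on the modules are zero. *)
Definition block_complex : free_complex K n :=
  FreeComplex
    (rk := fun i => match i with 0 => 1 | 1 => k.+1 | 2 => k | _ => 0 end)
    (fun i => match i with
       | 0 => fun=> 0
       | 1 => fun a => #|~: V a|%:Z
       | _ => fun=> n%:Z
     end)
    (fun i => match i with 0 => block_gens | 1 => block_syz | _ => 0 end)
    1%:M.

Hypothesis disjV : forall i j, i != j -> [disjoint V i & V j].

Lemma mul_block_gens (u : 'rV_k.+1) :
  (u *m block_gens) 0 0 = \sum_i u 0 i * X_ K (~: V i).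
Proof. by rewrite mxE; apply: eq_bigr => i _; rewrite mxE. Qed.

Lemma mul_block_syz0 (w : 'rV_k) :
  (w *m block_syz) 0 ord0 = - (\sum_i w 0 i) * X_ K (V ord0).
Proof.
rewrite mxE mulNr mulr_suml -sumrN; apply: eq_bigr => i _.
by rewrite mxE eqxx sub0r mulrN.
Qed.

Lemma mul_block_syz_lift (w : 'rV_k) i :
  (w *m block_syz) 0 (lift ord0 i) = w 0 i * X_ K (V (lift ord0 i)).
Proof.
rewrite mxE (bigD1 i) //= mxE eqxx subr0 big1 ?addr0 // => j ne_ji.
by rewrite mxE (inj_eq lift_inj) eq_sym (negPf ne_ji) subr0 mulr0.
Qed.

(** In a relation, q_j divides every term but the j-th, because V_j avoids the other blocks; so it
    divides the j-th term, and by coprimality the coefficient [u 0 j]. The quotients for j > 0 are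
    the coefficients [w], and coordinate 0 is then forced. *)
Lemma block_syz_exact (u : 'rV_k.+1) :
  u *m block_gens = 0 <-> exists w, u = w *m block_syz.
Proof.
have genE (w : 'rV_k.+1) : (w *m block_gens) 0 0 =
    w 0 ord0 * X_ K (~: V ord0)
    + \sum_(i < k) w 0 (lift ord0 i) * X_ K (~: V (lift ord0 i)).
  by rewrite mul_block_gens big_ord_recl.
split=> [/rowP/(_ 0)|[w ->]]; last first.
  apply/rowP => z; rewrite ord1 genE mul_block_syz0 mxE -mulrA.
  rewrite [X_ _ _ * _]mulrC X_mulC mulNr mulr_suml -sumrN -big_split big1 // => i _ /=.
  by rewrite mul_block_syz_lift -mulrA [X_ _ _ * _]mulrC X_mulC addNr.
move=> u0.
have /fin_all_exists[w defu] (i : 'I_k) :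
    exists g, u 0 (lift ord0 i) = g * X_ K (V (lift ord0 i)).
  have : u 0 (lift ord0 i) * X_ K (~: V (lift ord0 i)) =
         - \sum_(j | j != lift ord0 i) u 0 j * X_ K (~: V j).
    move: u0; rewrite mul_block_gens (bigD1 (lift ord0 i)) //= mxE.
    by move=> /eqP; rewrite addr_eq0 => /eqP.
  have [g ->] : exists g, - \sum_(j | j != lift ord0 i) u 0 j * X_ K (~: V j) =
      g * X_ K (V (lift ord0 i)).
    (* The condition sits under the existential so that finite choice gives [g] for all [j]; the
       excluded index gets the dummy 0. *)
    have dvd j : exists g, j != lift ord0 i ->
        u 0 j * X_ K (~: V j) = g * X_ K (V (lift ord0 i)).
      have [->|neq] := eqVneq j (lift ord0 i); first by exists 0.
      have [|g eg] := proj2 (X_dvdP (V (lift ord0 i)) (u 0 j * X_ K (~: V j))).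
        move=> m /(proj1 (X_dvdP _ _) (ex_intro _ (u 0 j) erefl)).
        by apply: subset_trans; rewrite subsets_disjoint setCK disjV // eq_sym.
      by exists g.
    have /fin_all_exists[g eg] := dvd.
    exists (- \sum_(j | j != lift ord0 i) g j).
    by rewrite mulNr mulr_suml; congr (- _); apply: eq_bigr.
  by apply: X_dvd_cancel; rewrite disjoint_sym -subsets_disjoint.
exists (\row_i w i); apply/rowP => j; have [i ->|->] := unliftP ord0 j.
  by rewrite mul_block_syz_lift mxE.
(* Coordinate 0 is compared after multiplication by its generator, where the relation itself
   determines it. *)
apply: (mulIf (X_neq0 K (~: V ord0))); rewrite mul_block_syz0 -mulrA.
rewrite [X_ _ _ * _]mulrC X_mulC mulNr mulr_suml.
move: u0; rewrite genE mxE => /eqP; rewrite addr_eq0 => /eqP ->.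
congr (- _); apply: eq_bigr => i _.
by rewrite mxE defu -mulrA [X_ _ _ * _]mulrC X_mulC.
Qed.

(** Outside column 0 the matrix is diagonal with nonzero entries. *)
Lemma block_syz_inj (w : 'rV_k) : w *m block_syz = 0 -> w = 0.
Proof.
move=> w0; apply/rowP => i; move/rowP/(_ (lift ord0 i)): w0.
rewrite mul_block_syz_lift !mxE => /eqP.
by rewrite mulf_eq0 (negPf (X_neq0 _ _)) orbF => /eqP.
Qed.

Lemma block_complex_graded : graded_complex block_complex.
Proof.
split=> [[|[|i]] a b|a]; last by rewrite /= ord1 mxE; apply: dhomog1.
- rewrite [diff _ _ _ _]mxE (_ : shift a - shift b = #|~: V a|%:Z).
    exact: X_homog.
  exact: subr0.
- rewrite [diff _ _ _ _]mxE (_ : shift a - shift b = #|V b|%:Z); last first.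
    by rewrite /= -{1}[n]card_ord -(cardsC (V b)) PoszD addrK.
  apply: graded_pieceD; last apply: graded_pieceN;
    by case: eqP => _; [exact: X_homog | exact: graded_piece0].
- by rewrite /= mxE; apply: graded_piece0.
Qed.

Lemma block_complex_resolves (I : R -> Prop) :
    (forall f, I f <-> exists w : 'rV_k.+1, f = (w *m block_gens) 0 0) ->
  resolves I block_complex.
Proof.
move=> defI; split=> [f|u|[|i] u].
- exists f%:M; rewrite /= mulmx1 mxE eqxx subrr; apply/defI.
  by exists 0; rewrite mul0mx mxE.
- rewrite /= mulmx1; split=> [/defI[w defu]|[w ->]].
    by exists w; apply/rowP => i; rewrite ord1.
  by apply/defI; exists w.
- exact: block_syz_exact.
- split=> [u0|[w ->]]; last by rewrite /= mulmx0 mul0mx.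
  (* Cycles vanish here: in degree 2 by injectivity, above it because the rank is 0. *)
  exists 0; rewrite mul0mx; case: i u u0 => [|i] u u0; last first.
    by apply/rowP => -[].
  exact: block_syz_inj.
Qed.

Hypothesis V_neq0 : forall i, V i != set0.

Lemma block_compl_neq0 : (0 < k)%N -> forall i, ~: V i != set0.
Proof.
move=> k_gt0 i; have [j neqji] : exists j, j != i.
  by have [->|neq] := eqVneq i ord0; [exists (inord 1) | exists ord0];
    rewrite // -val_eqE /= ?inordK // eq_sym.
have /set0Pn[x xj] := V_neq0 j; apply/set0Pn; exists x.
by rewrite inE (disjointFr (disjV neqji)).
Qed.

Lemma block_complex_minimal : (0 < k)%N -> minimal_complex block_complex.
Proof.
move=> k_gt0 [|[|i]] a b /=; rewrite mxE ?mcoeff0 //.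
  exact/X_mcoeff0/block_compl_neq0.
by rewrite mcoeffB !mcoeffMn X_mcoeff0 // !mul0rn subrr.
Qed.

Lemma card_block i : (0 < k)%N ->
  [/\ (0 < #|V i|)%N, (0 < #|~: V i|)%N & (#|V i| + #|~: V i|)%N = n].
Proof.
by move=> k_gt0; rewrite !card_gt0 V_neq0 block_compl_neq0 // cardsC card_ord.
Qed.

(** The values are 0, n - |V_a| - 1 and n - 2. Nonempty blocks bound the second, and two of them
    give n >= 2, so the truncated subtraction is exact. *)
Lemma block_complex_shift i (a : 'I_(rk block_complex i)) :
  (0 < k)%N -> shift a - i%:Z <= (n - 2)%N%:Z.
Proof.
move=> k_gt0; have [V0 cV0 cardV0] := card_block ord0 k_gt0.
case: i a => [|[|[|i]]] a /=; [lia| |lia|by case: a].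
by case: (card_block a k_gt0); set x := #|V a|; set y := #|~: V a|; lia.
Qed.

Lemma regularity_blocks (I : R -> Prop) :
    (0 < k)%N -> is_ideal I ->
    (forall z f, I f -> I (homog_part z f)) ->
    (forall f, I f <-> exists w : 'rV_k.+1, f = (w *m block_gens) 0 0) ->
  is_regularity I (n - 2)%N.
Proof.
move=> k_gt0 idI gI defI.
have resI := block_complex_resolves defI.
have grI := block_complex_graded.
split=> [|z [i] [j] [b] [[F [minF ->]]]].
  (* The maximum is attained by the [k] syzygies, all of degree n in homological degree 2. *)
  exists 2, n%:Z, k; split; first exists block_complex.
  - split; first by split=> //; apply: block_complex_minimal.
    by rewrite cardsE -[LHS]card_ord; apply: eq_card => a; rewrite inE;
      exact/esym/(eqxx n).
  - by case: k k_gt0.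
  - by have [? ? ?] := card_block ord0 k_gt0; lia.
rewrite cards_eq0 => /set0Pn[a]; rewrite inE => /eqP <- ->.
have [c <-] := minimal_resolution_shift a idI gI minF resI grI.
exact: block_complex_shift.
Qed.

End DisjointBlocks.

(** * Complete multipartite graphs: minimal covers, regularity and the lower bound for v *)

Section CompleteMultipartite.
Variables (K : fieldType) (n : nat) (E : rel 'I_n) (P : {set {set 'I_n}}).
Hypotheses (E_edge : exists a b, E a b) (partP : partition P [set: 'I_n])
  (P_indep : forall A, A \in P -> {in A &, forall a b, ~~ E a b})
  (P_join : forall A B, A \in P -> B \in P -> A != B ->
     {in A & B, forall a b, E a b}).

Lemma mem_block (i : 'I_n) : exists2 A, A \in P & i \in A.
Proof.
have : i \in cover P by rewrite (cover_partition partP) inE.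
by case/bigcupP => A; exists A.
Qed.

Lemma block_neq0 A : A \in P -> A != set0.
Proof. by case/and3P: partP => _ _ P0 AP; apply: contraNneq P0 => <-. Qed.

Lemma block_disjoint A B : A \in P -> B \in P -> A != B -> [disjoint A & B].
Proof. by case/and3P: partP => _ /trivIsetP disjP _; apply: disjP. Qed.

Lemma edge_out A i j : A \in P -> i \in A -> j \notin A -> E i j.
Proof.
move=> AP iA jA; have [B BP jB] := mem_block j.
by apply: (P_join AP BP) => //; apply: contraNneq jA => ->.
Qed.

Lemma vertex_cover_block A : A \in P -> vertex_cover E (~: A).
Proof.
move=> AP; apply/forallP => a; apply/forallP => b; apply/implyP; rewrite !inE.
by rewrite -negb_and; apply: contraL => /andP[aA bA]; apply: (P_indep AP).
Qed.

(** A vertex missed by a cover C forces all its neighbours, that is the complement of its block,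
    into C. Conversely, dropping a vertex from the complement of a block uncovers its edges to that
    block. *)
Lemma minimal_vertex_cover_block C :
  minimal_vertex_cover E C = (~: C \in P).
Proof.
have min_block A : A \in P -> minimal_vertex_cover E (~: A).
  move=> AP; apply/minsetP; split; first exact: vertex_cover_block.
  move=> D coverD sDA; apply/eqP; rewrite eqEsubset sDA /=.
  apply/subsetP => i; rewrite inE => iA.
  have /set0Pn[j jA] := block_neq0 AP.
  move: coverD => /forallP/(_ j)/forallP/(_ i)/implyP/(_ (edge_out AP jA iA)).
  by case/orP => // /(subsetP sDA); rewrite inE jA.
apply/idP/idP => [/minsetP[coverC minC]|/min_block]; last by rewrite setCK.
suff [A AP sAC] : exists2 A, A \in P & ~: A \subset C.
  by rewrite -(minC _ (vertex_cover_block AP) sAC) setCK.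
(* If C misses no vertex, any block will do. *)
have [/existsP[a aC]|/existsPn fullC] := boolP [exists a, a \notin C].
  have [A AP aA] := mem_block a; exists A => //; apply/subsetP => i.
  rewrite inE => iA; move: coverC.
  move=> /forallP/(_ a)/forallP/(_ i)/implyP/(_ (edge_out AP aA iA)).
  by rewrite (negPf aC).
have [a _] := E_edge; have [A AP _] := mem_block a; exists A => //.
by apply/subsetP => i _; apply/negPn/fullC.
Qed.

Lemma cover_ideal_block A : A \in P -> cover_ideal K E (X_ K (~: A)).
Proof.
by move=> AP; apply: cover_ideal_X; rewrite minimal_vertex_cover_block setCK.
Qed.

Lemma card_blocks : (1 < #|P|)%N.
Proof.
have [a [b Eab]] := E_edge; have [A AP aA] := mem_block a.
have [B BP bB] := mem_block b; apply/card_gt1P; exists A, B; split=> //.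
by apply: contraTneq Eab => eqAB; apply: (P_indep AP); rewrite // eqAB.
Qed.

Lemma multipartite_regularity : is_regularity (cover_ideal K E) (n - 2)%N.
Proof.
have idJ := cover_ideal_is_ideal K E.
(* One block is set aside as the reference block 0 of the syzygies. *)
have [k eqk] : exists k, k.+1 = #|P|.
  by exists #|P|.-1; rewrite prednK // ltnW ?card_blocks.
pose V (i : 'I_k.+1) := enum_val (cast_ord eqk i).
have VP i : V i \in P by apply: enum_valP.
apply: (@regularity_blocks K n k V) => //.
- move=> i j neq_ij; apply: block_disjoint => //.
  by apply: contraNneq neq_ij => /enum_val_inj/cast_ord_inj ->.
- by move=> i; apply: block_neq0.
- by rewrite -ltnS eqk card_blocks.
- exact: cover_ideal_homog_part.
move=> f; split=> [|[w ->]]; last first.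
  rewrite mul_block_gens; apply: ideal_sum => // i _.
  by case: idJ => _ _; apply; apply: cover_ideal_block.
apply: (cover_ideal_sub
          (I := fun f => exists w, f = (w *m block_gens K V) 0 0)).
  split=> [|g h [u ->] [v ->]|g h [u ->]].
  - by exists 0; rewrite mul0mx mxE.
  - by exists (u + v); rewrite mulmxDl [RHS]mxE.
  - by exists (g *: u); rewrite -scalemxAl [RHS]mxE.
move=> C; rewrite minimal_vertex_cover_block => CP.
pose i := cast_ord (esym eqk) (enum_rank_in CP (~: C)).
exists (delta_mx 0 i); rewrite -rowE !mxE /V cast_ordKV enum_rankK_in //.
by rewrite setCK.
Qed.

Lemma multipartite_v_lower (f : {mpoly K[n]}) (p : {mpoly K[n]} -> Prop) d :
    f \is d.-homog -> associated_prime (cover_ideal K E) p ->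
    same_ideal (colon (cover_ideal K E) f) p ->
  (n - 2 <= d)%N.
Proof.
move=> homf [primep _] Jf_p; have idJ := cover_ideal_is_ideal K E.
(* J is contained in J : f, so the prime contains each generator and hence one of its variables. *)
have pX A : A \in P -> exists2 i, i \in ~: A & p 'X_i.
  move=> AP; apply: prime_X_mem => //; apply/Jf_p; rewrite /colon mulrC.
  by case: idJ => _ _; apply; apply: cover_ideal_block.
(* The first block only serves to find some x_b in [p]; avoiding the block of [b] then gives x_a
   from a different block. *)
have [a0 _] := E_edge; have [A AP _] := mem_block a0.
have [b _] := pX A AP; have [B BP bB] := mem_block b; have [a aB] := pX B BP.
have neq_ab : a != b by apply: contraTneq aB => ->; rewrite inE bB.
move=> /Jf_p/cover_ideal_msupp/allP Ja /Jf_p/cover_ideal_msupp/allP Jb.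
(* If every term of [f] were in J, then 1 would lie in J : f, contradicting primality. *)
have [/allP Jf|/allPn[m mf notJm]] := boolP (all (mnm_covers E) (msupp f)).
  case: primep => _ []; apply/Jf_p; rewrite /colon mul1r.
  exact/cover_ideal_msupp/allP.
have varX c : (forall m', m' \in msupp ('X_c * f) -> mnm_covers E m') ->
    exists2 C, ~: C \in P & C \subset c |: mnm_vars m.
  move=> /(_ (U_(c) + m)%MM); rewrite mulrC (perm_mem (msuppMX _ _)) map_f //.
  move=> /(_ isT)/mnm_coversP[C]; rewrite minimal_vertex_cover_block.
  by rewrite mnm_varsD mnm_varsU; exists C.
have [C CP sCa] := varX a Ja; have [D DP sDb] := varX b Jb.
(* x_a m and x_b m are multiples of X_C and X_D; if C = D then m itself is one,
   and otherwise C and D, complements of distinct blocks, cover V(G). *)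
have neqCD : ~: C != ~: D.
  apply: contraNneq notJm => /setC_inj eqCD; apply/mnm_coversP; exists C.
    by rewrite minimal_vertex_cover_block.
  apply/subsetP => i iC; have := subsetP sCa i iC.
  rewrite eqCD in iC; have := subsetP sDb i iC.
  by rewrite !inE => /predU1P[->|->//]; rewrite eq_sym (negPf neq_ab).
have cov : [set: 'I_n] \subset [set a; b] :|: mnm_vars m.
  apply/subsetP => i _.
  have := disjointFr (block_disjoint CP DP neqCD) (x := i).
  rewrite !inE; case: (boolP (i \in C)) => [iC _|_ /(_ isT)/negbFE iD].
    by have := subsetP sCa i iC; rewrite !inE => /orP[->|->]; rewrite ?orbT.
  by have := subsetP sDb i iD; rewrite !inE => /orP[->|->]; rewrite ?orbT.
rewrite leq_subLR -[n in (n <= _)%N]card_ord -cardsT.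
apply: leq_trans (subset_leq_card cov) (leq_trans (leq_card_setU _ _) _).
rewrite cards2 neq_ab leq_add2l (leq_trans (card_mnm_vars m)) //.
by move/dhomogP: homf => /(_ m mf) <-.
Qed.

End CompleteMultipartite.

Theorem theorem3p6 (K : fieldType) (n : nat) (E : rel 'I_n)
    (E_simple : simple_graph E)
    (E_multipartite : complete_multipartite E)
    (E_edge : exists a b : 'I_n, E a b) :
  is_v_number (cover_ideal K E) (#|'I_n| - 2)%N /\
  is_regularity (cover_ideal K E) (Posz (#|'I_n| - 2)%N).
Proof.
have [P [partP P_indep P_join]] := E_multipartite.
rewrite card_ord; split; last exact: multipartite_regularity P_join.
split=> [|d [f [p [homf assp Jf]]]].
  by have [a [b Eab]] := E_edge; apply: v_number_witness Eab.
exact: (multipartite_v_lower E_edge partP P_indep P_join homf assp Jf).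
Qed.
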